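(* Let $\tilde A_i=(a_i;\,l_i^{\mu L},r_i^{\mu L},l_i^{\mu U},r_i^{\mu U};\,l_i^{\nu L},r_i^{\nu L},l_i^{\nu U},r_i^{\nu U})_{LR}$, $i=1,2$, be $LR$-type IVIFNs with the same shape functions, where $a_1-l_1^{\nu L}<0$ and $a_1-l_1^{\nu U}\ge0$, and $\tilde A_2$ is arbitrary. Then $\tilde A_1\odot\tilde A_2=(a;\,l^{\mu L},r^{\mu L},l^{\mu U},r^{\mu U};\,l^{\nu L},r^{\nu L},l^{\nu U},r^{\nu U})_{LR}$, where $a=a_1a_2$; for each $\kappa\in\{\mu L,\mu U,\nu U\}$, $$l^\kappa=a_1a_2-\min\{(a_1-l_1^\kappa)(a_2-l_2^\kappa),(a_1+r_1^\kappa)(a_2-l_2^\kappa)\},\quad r^\kappa=\max\{(a_1-l_1^\kappa)(a_2+r_2^\kappa),(a_1+r_1^\kappa)(a_2+r_2^\kappa)\}-a_1a_2;$$ and for $\kappa=\nu L$, $$l^\kappa=a_1a_2-\min\{(a_1-l_1^\kappa)(a_2+r_2^\kappa),(a_1+r_1^\kappa)(a_2-l_2^\kappa)\},\quad r^\kappa=\max\{(a_1-l_1^\kappa)(a_2-l_2^\kappa),(a_1+r_1^\kappa)(a_2+r_2^\kappa)\}-a_1a_2.$$ Moreover the conditions for an $LR$-type representation hold: all eight spreads of the product are positive and $l^{\mu U}\ge l^{\mu L}$, $l^{\nu L}\ge l^{\nu U}$, $l^{\nu L}\ge l^{\mu L}$, $l^{\nu U}\ge l^{\mu U}$, and likewise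 with $r$ in place of $l$.
   Context: A shape function is a continuous, strictly decreasing, invertible $f:[0,\infty)\to[0,1]$ with $f(0)=1$ and $\lim_{x\to\infty}f(x)=0$. Fix shape functions $L,R,L',R'$. An $LR$-type interval-valued intuitionistic fuzzy number (IVIFN) is written $\tilde A=(a;l^{\mu L},r^{\mu L},l^{\mu U},r^{\mu U};l^{\nu L},r^{\nu L},l^{\nu U},r^{\nu U})_{LR}$, where $a\in\mathbb R$ is its mean value and the eight spreads are positive reals with $l^{\mu U}\ge l^{\mu L}$, $r^{\mu U}\ge r^{\mu L}$, $l^{\nu L}\ge l^{\nu U}$, $r^{\nu L}\ge r^{\nu U}$, $l^{\nu L}\ge l^{\mu L}$, $r^{\nu L}\ge r^{\mu L}$, $l^{\nu U}\ge l^{\mu U}$, $r^{\nu U}\ge r^{\mu U}$. It encodes a lower membership function equal to $L((a-x)/l^{\mu L})$ on $[a-l^{\mu L},a]$, $R((x-a)/r^{\mu L})$ on $[a,a+r^{\mu L}]$, and $0$ otherwise; an upper membership function of the same form with $L',R',l^{\mu U},r^{\mu U}$; a lower non-membership function equal to $1-L((a-x)/l^{\nu L})$ on $[a-l^{\nu L},a]$, $1-R((x-a)/r^{\nu L})$ on $[a,a+r^{\nu L}]$, and $1$ otherwise; and an upper non-membership function of the same form with $L',R',l^{\nu U},r^{\nu U}$. At each $x$ the supremum of the membership interval plus the supremum of the non-membership interval is at most $1$. The product $\tilde A_1\odot\tilde A_2$ is formed cutwise by interval multiplication and read off at the level where the inverse shape functions equal $0$ (giving the mean) and at the level where they equal $1$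 (giving the spreads). That is, it is the tuple (with the same shape functions) with mean $a=a_1a_2$ and spreads determined, for each $\kappa\in\{\mu L,\mu U,\nu L,\nu U\}$, by $$[a-l^{\kappa},a+r^{\kappa}]=[a_1-l_1^{\kappa},a_1+r_1^{\kappa}]\times[a_2-l_2^{\kappa},a_2+r_2^{\kappa}],$$ where $I\times J=\{xy:x\in I,y\in J\}$. *)

(* Defs.v *)
From HB Require Import structures.
From mathcomp Require Import all_boot all_order all_algebra.
From mathcomp Require Import all_classical all_reals all_analysis.

Set Implicit Arguments.
Unset Strict Implicit.
Unset Printing Implicit Defensive.

Import Order.TTheory GRing.Theory Num.Theory.
Import numFieldNormedType.Exports.

Local Open Scope classical_set_scope.
Local Open Scope ring_scope.

(* Only the values of f on [0, +oo[ matter. A strictly decreasing f with limit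
   0 never takes the value 0, so invertibility can only mean that f is a
   bijection from [0, +oo[ onto ]0, 1]. *)
Record shape_function (R : realType) (f : R -> R) : Prop := ShapeFunction {
  shape_itv : forall x, 0 <= x -> 0 <= f x <= 1;
  shape_continuous : {within `[0, +oo[, continuous f};
  shape_decreasing : forall x y, 0 <= x -> x < y -> f y < f x;
  shape_invertible : set_bij `[0, +oo[ `]0, 1] f;
  shape0 : f 0 = 1;
  shape_cvg : f x @[x --> +oo] --> (0 : R) }.

(* mu / nu : membership / non-membership; L / U : lower / upper function. *)
Inductive kind := muL | muU | nuL | nuU.

Record lr_tuple (R : realType) := LRTuple {
  mean : R;
  lspread : kind -> R;
  rspread : kind -> R }.

Section Definitions.
Variable R : realType.
Implicit Types (f g : R -> R) (A : lr_tuple R) (k : kind) (x : R).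

Definition left_end A k : R := mean A - lspread A k.
Definition right_end A k : R := mean A + rspread A k.

Definition membership f g A k x : R :=
  if left_end A k <= x <= mean A then f ((mean A - x) / lspread A k)
  else if mean A <= x <= right_end A k then g ((x - mean A) / rspread A k)
  else 0.

Definition nonmembership f g A k x : R :=
  if left_end A k <= x <= mean A then 1 - f ((mean A - x) / lspread A k)
  else if mean A <= x <= right_end A k then 1 - g ((x - mean A) / rspread A k)
  else 1.

Definition membership_interval fL fR fL' fR' A x : set R :=
  `[membership fL fR A muL x, membership fL' fR' A muU x].

Definition nonmembership_interval fL fR fL' fR' A x : set R :=
  `[nonmembership fL fR A nuL x, nonmembership fL' fR' A nuU x].

(* Shared by the left and the right spreads. *)
Definition admissible_spreads (s : kind -> R) : Prop :=
  (forall k, 0 < s k) /\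
  [/\ s muL <= s muU, s nuU <= s nuL, s muL <= s nuL & s muU <= s nuU].

(* mu^L <= mu^U and nu^L <= nu^U pointwise are not required: they would relate
   L, R to L', R', and products need not preserve them. Where one of these
   intervals is empty its sup is 0 by convention. *)
Definition LR_IVIFN fL fR fL' fR' A : Prop :=
  [/\ admissible_spreads (lspread A), admissible_spreads (rspread A) &
      forall x, sup (membership_interval fL fR fL' fR' A x) +
                sup (nonmembership_interval fL fR fL' fR' A x) <= 1].

(* A relation in A: the set equations determine the spreads of the product. *)
Definition IVIFN_product A1 A2 A : Prop :=
  mean A = mean A1 * mean A2 /\
  forall k, `[left_end A k, right_end A k]%classic =
    [set x * y | x in `[left_end A1 k, right_end A1 k]%classic
               & y in `[left_end A2 k, right_end A2 k]%classic].

End Definitions.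

(* Main.v *)
(* Bilinearity puts the extreme values of xy on a rectangle at corners, and the
   sign pattern of the endpoints of A1 selects which corners compete. Each
   support of the product is thus the predicted interval. Supports of A1 and A2
   nested in one another have nested products, which gives the inequalities
   between the spreads; since mean A1 > 0, multiplying it by the ends of the
   support of A2 gives points on both sides of mean A1 * mean A2, so the spreads
   are positive. *)
Require Import Defs.
From HB Require Import structures.
From mathcomp Require Import all_boot all_order all_algebra.
From mathcomp Require Import all_classical all_reals all_analysis.
From mathcomp Require Import lra.

Set Implicit Arguments.
Unset Strict Implicit.
Unset Printing Implicit Defensive.

Import Order.TTheory GRing.Theory Num.Theory.
Import numFieldNormedType.Exports.

Local Open Scope classical_set_scope.
Local Open Scope ring_scope.

(** * Products of closed real intervals *)

Section IntervalMul.
Variable R : realType.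
Implicit Types a b c d m M x y : R.

(* The product is continuous along the segment joining the two points where
   the extreme values are attained, so IVT supplies the values in between. *)
Lemma mul_itv_extrema a b c d m M :
  (forall x y, a <= x <= b -> c <= y <= d -> m <= x * y <= M) ->
  (exists x y, [/\ a <= x <= b, c <= y <= d & x * y = m]) ->
  (exists x y, [/\ a <= x <= b, c <= y <= d & x * y = M]) ->
  [set x * y | x in `[a, b]%classic & y in `[c, d]%classic] = `[m, M]%classic.
Proof.
move=> bnd [x0 [y0 [x0ab y0cd m_def]]] [x1 [y1 [x1ab y1cd M_def]]].
apply/seteqP; split => z /=.
  by case=> x; rewrite /= in_itv /= => xab [y]; rewrite /= in_itv /= => ycd <-;
    rewrite in_itv /= bnd.
rewrite in_itv /= => /andP[mz zM].
pose p t : R := (x0 + t * (x1 - x0)) * (y0 + t * (y1 - y0)).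
have p0 : p 0 = m by rewrite /p !mul0r !addr0.
have p1 : p 1 = M by rewrite /p !mul1r !subrKC.
have cp : {within `[0, 1], continuous p}.
  apply: continuous_subspaceT => t.
  by apply: cvgM; apply: cvgD; [exact: cvg_cst | | exact: cvg_cst | ];
    apply: cvgM => //; exact: cvg_cst.
have [|t] := IVT ler01 cp (v := z).
  by rewrite p0 p1 ge_min mz /= le_max zM orbT.
rewrite in_itv /= => t01 <-; exists (x0 + t * (x1 - x0)).
  by rewrite /= in_itv /=; nra.
by exists (y0 + t * (y1 - y0)) => //=; rewrite in_itv /=; nra.
Qed.

(** Every [x] in the first interval is nonnegative, so [x * y] lies between [x * c] and [x * d].
    These are linear in [x]; the signs of [c] and [d] decide which of [a], [b] is extremal. *)
Lemma mul_itv_ge0 a b c d : 0 <= a -> a <= b -> c <= d ->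
  [set x * y | x in `[a, b]%classic & y in `[c, d]%classic] =
  `[Num.min (a * c) (b * c), Num.max (a * d) (b * d)]%classic.
Proof.
move=> a0 ab cd; apply: mul_itv_extrema => [x y xab ycd||].
- rewrite ge_min le_max.
  have [c0|c0] := leP 0 c; have [d0|d0] := leP 0 d; apply/andP; split;
    apply/orP; try (by left; nra); try (by right; nra).
- by case: leP => _; [exists a, c | exists b, c]; rewrite !lexx ab cd.
- by case: leP => _; [exists b, d | exists a, d]; rewrite !lexx ab cd.
Qed.

(** Here [a * d <= a * c] and [b * c <= b * d], which leaves two candidate corners for each extreme.
    The monotonicity of [x * y] in [y] changes with the sign of [x], hence the extra case split. *)
Lemma mul_itv_mixed a b c d : a <= 0 -> 0 <= b -> c <= d ->
  [set x * y | x in `[a, b]%classic & y in `[c, d]%classic] =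
  `[Num.min (a * d) (b * c), Num.max (a * c) (b * d)]%classic.
Proof.
move=> a0 b0 cd; have ab := le_trans a0 b0.
apply: mul_itv_extrema => [x y xab ycd||].
- rewrite ge_min le_max.
  have [c0|c0] := leP 0 c; have [d0|d0] := leP 0 d;
  have [x0|x0] := leP 0 x; apply/andP; split;
    apply/orP; try (by left; nra); try (by right; nra).
- by case: leP => _; [exists a, d | exists b, c]; rewrite !lexx ab cd.
- by case: leP => _; [exists b, d | exists a, c]; rewrite !lexx ab cd.
Qed.

(** The sign condition covers the empty interval, whose [sup] is 0. *)
Lemma le_sup_itvcc a b : 0 <= b -> sup `[a, b]%classic <= b.
Proof.
move=> b0; have [ab|ba] := leP a b; first by rewrite sup_itvcc.
by rewrite set_itv_ge ?sup0 // bnd_simp -ltNge.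
Qed.

Lemma subset_itvcc a b c d : a <= b ->
  `[a, b]%classic `<=` `[c, d]%classic -> c <= a /\ b <= d.
Proof.
move=> ab sub; have := sub a; have := sub b.
rewrite /= !in_itv /= !lexx ab => /(_ isT) /andP[_ bd] /(_ isT) /andP[ca _].
by [].
Qed.

End IntervalMul.

(** * Membership functions and supports of LR tuples *)

Section LRTuples.
Variable R : realType.
Implicit Types (f g : R -> R) (A : lr_tuple R) (k : kind) (x : R).

Lemma shape_le f : shape_function f ->
  forall x y, 0 <= x -> x <= y -> f y <= f x.
Proof.
move=> hf x y x0; rewrite le_eqVlt => /predU1P[-> //|xy].
exact/ltW/(shape_decreasing hf).
Qed.

Lemma nonmembershipE f g A k x :
  nonmembership f g A k x = 1 - membership f g A k x.
Proof.
by rewrite /nonmembership /membership; do 2![case: ifP => // _]; rewrite subr0.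
Qed.

Lemma membership_itv f g A k x : shape_function f -> shape_function g ->
  0 < lspread A k -> 0 < rspread A k -> 0 <= membership f g A k x <= 1.
Proof.
move=> hf hg l0 r0; rewrite /membership.
case: ifP => [/andP[_ xm]|_].
  by apply: shape_itv => //; rewrite divr_ge0 ?subr_ge0 // ltW.
case: ifP => [/andP[mx _]|_]; last by rewrite lexx ler01.
by apply: shape_itv => //; rewrite divr_ge0 ?subr_ge0 // ltW.
Qed.

(** Larger spreads bring the argument of [f] or [g] closer to 0, where a decreasing function is
    larger. Off the support of [k] the left side is 0. *)
Lemma membership_le f g A k k' x : shape_function f -> shape_function g ->
  0 < lspread A k -> 0 < rspread A k ->
  lspread A k <= lspread A k' -> rspread A k <= rspread A k' ->
  membership f g A k x <= membership f g A k' x.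
Proof.
move=> hf hg l0 r0 ll rr.
have l0' := lt_le_trans l0 ll; have r0' := lt_le_trans r0 rr.
have /andP[ge0 _] := membership_itv x hf hg l0' r0'.
rewrite {1}/membership; case: ifP => [/andP[lx xm]|Nl].
  rewrite /membership ifT; last by rewrite /left_end in lx *; lra.
  apply: shape_le => //; first by rewrite divr_ge0 ?subr_ge0 // ltW.
  by rewrite ler_wpM2l ?subr_ge0 // lef_pV2.
case: ifP => [/andP[mx xr]|//].
(* At [x = mean A] the left branch takes precedence, so reaching the right branch forces strict
   inequality. This rules out the left branch for [k'] as well. *)
have {Nl} mx' : mean A < x.
  by rewrite ltNge; apply: contraFN Nl => xm; rewrite /left_end; lra.
rewrite /membership ifF; last by rewrite [x <= _]leNgt mx' andbF.
rewrite ifT; last by rewrite /right_end in xr *; lra.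
apply: shape_le => //; first by rewrite divr_ge0 ?subr_ge0 // ltW.
by rewrite ler_wpM2l ?subr_ge0 // lef_pV2.
Qed.

(* The admissibility of the spreads makes mu^U(x) at most 1 - nu^U(x), so the
   sup condition in the definition of an IVIFN is automatic. *)
Lemma admissible_LR_IVIFN fL fR fL' fR' A :
  shape_function fL' -> shape_function fR' ->
  admissible_spreads (lspread A) -> admissible_spreads (rspread A) ->
  LR_IVIFN fL fR fL' fR' A.
Proof.
move=> hL hR hl hr; split=> // x.
have [l0 [_ _ _ lU]] := hl; have [r0 [_ _ _ rU]] := hr.
have /andP[mu0 _] := membership_itv x hL hR (l0 muU) (r0 muU).
have /andP[_ nu1] := membership_itv x hL hR (l0 nuU) (r0 nuU).
have le_mu := membership_le x hL hR (l0 muU) (r0 muU) lU rU.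
rewrite /membership_interval /nonmembership_interval.
apply: (le_trans (lerD (le_sup_itvcc _ mu0) (le_sup_itvcc _ _)));
  rewrite nonmembershipE; lra.
Qed.

(** For positive spreads, [membership] is 0 and [nonmembership] is 1 outside this interval. *)
Definition lr_support A k : set R := `[left_end A k, right_end A k]%classic.

Lemma lr_support_le A k k' : lspread A k <= lspread A k' ->
  rspread A k <= rspread A k' -> lr_support A k `<=` lr_support A k'.
Proof.
move=> ll rr x; rewrite /lr_support /left_end /right_end /= !in_itv /=; lra.
Qed.

Lemma mem_lr_support A k x :
  lr_support A k x =
  (mean A - lspread A k <= x <= mean A + rspread A k) :> Prop.
Proof. by rewrite /lr_support /= in_itv. Qed.

Lemma lr_support_mean_ends A k : 0 < lspread A k -> 0 < rspread A k ->
  [/\ lr_support A k (mean A), lr_support A k (left_end A k)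
    & lr_support A k (right_end A k)].
Proof.
by move=> l0 r0; rewrite !mem_lr_support /left_end /right_end; split; lra.
Qed.

(** * Admissibility and uniqueness of the product *)

Section Product.
Variables A1 A2 : lr_tuple R.
Hypotheses (hl1 : admissible_spreads (lspread A1))
           (hr1 : admissible_spreads (rspread A1))
           (hl2 : admissible_spreads (lspread A2))
           (hr2 : admissible_spreads (rspread A2)).

Lemma product_support_mul A k x y : IVIFN_product A1 A2 A ->
  lr_support A1 k x -> lr_support A2 k y -> lr_support A k (x * y).
Proof.
by move=> [_ /(_ k) E] ? ?; rewrite /lr_support E; exists x => //; exists y.
Qed.

Lemma product_support_le A k k' : IVIFN_product A1 A2 A ->
  lspread A1 k <= lspread A1 k' -> rspread A1 k <= rspread A1 k' ->
  lspread A2 k <= lspread A2 k' -> rspread A2 k <= rspread A2 k' ->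
  lspread A k <= lspread A k' /\ rspread A k <= rspread A k'.
Proof.
move=> hA ? ? ? ?.
(* The product of the two means witnesses that the support of [A] at [k] is nonempty; only then does
   inclusion of intervals compare their ends. *)
have [m1 _ _] := lr_support_mean_ends (hl1.1 k) (hr1.1 k).
have [m2 _ _] := lr_support_mean_ends (hl2.1 k) (hr2.1 k).
have := product_support_mul hA m1 m2; rewrite mem_lr_support => mA.
have : lr_support A k `<=` lr_support A k'.
  rewrite {1}/lr_support; case: (hA) => _ -> _ [x xA1 [y yA2 <-]].
  by apply: (product_support_mul hA);
    [apply: (lr_support_le _ _ xA1) | apply: (lr_support_le _ _ yA2)].
move=> /subset_itvcc[]; rewrite /left_end /right_end; last split; lra.
Qed.

Lemma product_spreads_gt0 A k : 0 < mean A1 -> IVIFN_product A1 A2 A ->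
  0 < lspread A k /\ 0 < rspread A k.
Proof.
move=> a1_gt0 hA; have l2 := hl2.1 k; have r2 := hr2.1 k.
have [m1 _ _] := lr_support_mean_ends (hl1.1 k) (hr1.1 k).
have [_ L2 R2] := lr_support_mean_ends l2 r2.
have := product_support_mul hA m1 L2; have := product_support_mul hA m1 R2.
rewrite !mem_lr_support hA.1 /left_end /right_end => /andP[_ hr] /andP[hl _].
by split; nra.
Qed.

Lemma product_admissible A : 0 < mean A1 -> IVIFN_product A1 A2 A ->
  admissible_spreads (lspread A) /\ admissible_spreads (rspread A).
Proof.
move=> a1_gt0 hA; have pos k := product_spreads_gt0 k a1_gt0 hA.
have [_ [l1a l1b l1c l1d]] := hl1; have [_ [r1a r1b r1c r1d]] := hr1.
have [_ [l2a l2b l2c l2d]] := hl2; have [_ [r2a r2b r2c r2d]] := hr2.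
have [? ?] := product_support_le hA l1a r1a l2a r2a.
have [? ?] := product_support_le hA l1b r1b l2b r2b.
have [? ?] := product_support_le hA l1c r1c l2c r2c.
have [? ?] := product_support_le hA l1d r1d l2d r2d.
by split; split=> // k; have [] := pos k.
Qed.

(** A nonempty closed interval determines its ends, and these together with the common mean
    determine the spreads. *)
Lemma product_unique A B :
  IVIFN_product A1 A2 A -> IVIFN_product A1 A2 B -> A = B.
Proof.
move=> hA hB.
have mAB : mean A = mean B by rewrite hA.1 hB.1.
have nested C D k : IVIFN_product A1 A2 C -> IVIFN_product A1 A2 D ->
    left_end D k <= left_end C k /\ right_end C k <= right_end D k.
  move=> hC hD; apply: subset_itvcc; last by rewrite hC.2 hD.2.
  have [m1 _ _] := lr_support_mean_ends (hl1.1 k) (hr1.1 k).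
  have [m2 _ _] := lr_support_mean_ends (hl2.1 k) (hr2.1 k).
  have := product_support_mul hC m1 m2.
  by rewrite /lr_support /= in_itv /=; lra.
have ends k : lspread A k = lspread B k /\ rspread A k = rspread B k.
  have := nested A B k hA hB; have := nested B A k hB hA.
  by rewrite /left_end /right_end => -[? ?] [? ?]; split; lra.
case: A B mAB ends {hA hB} => a l r [b l' r'] /= <- ends.
by congr LRTuple; apply/funext => k; have [] := ends k.
Qed.

End Product.
End LRTuples.

Theorem proposition3p1p3 (R : realType) (fL fR fL' fR' : R -> R)
    (hL : shape_function fL) (hR : shape_function fR)
    (hL' : shape_function fL') (hR' : shape_function fR')
    (A1 A2 : lr_tuple R)
    (hA1 : LR_IVIFN fL fR fL' fR' A1) (hA2 : LR_IVIFN fL fR fL' fR' A2)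
    (hneg : mean A1 - lspread A1 nuL < 0)
    (hpos : 0 <= mean A1 - lspread A1 nuU) :
  let a1 := mean A1 in let l1 := lspread A1 in let r1 := rspread A1 in
  let a2 := mean A2 in let l2 := lspread A2 in let r2 := rspread A2 in
  let A := LRTuple (a1 * a2)
    (fun k => match k with
     | muL | muU | nuU =>
         a1 * a2 - Num.min ((a1 - l1 k) * (a2 - l2 k))
                           ((a1 + r1 k) * (a2 - l2 k))
     | nuL =>
         a1 * a2 - Num.min ((a1 - l1 k) * (a2 + r2 k))
                           ((a1 + r1 k) * (a2 - l2 k))
     end)
    (fun k => match k with
     | muL | muU | nuU =>
         Num.max ((a1 - l1 k) * (a2 + r2 k))
                 ((a1 + r1 k) * (a2 + r2 k)) - a1 * a2
     | nuL =>
         Num.max ((a1 - l1 k) * (a2 - l2 k))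
                 ((a1 + r1 k) * (a2 + r2 k)) - a1 * a2
     end) in
  unique (IVIFN_product A1 A2) A /\ LR_IVIFN fL fR fL' fR' A.
Proof.
have [hl1 hr1 _] := hA1; have [hl2 hr2 _] := hA2 => a1 l1 r1 a2 l2 r2 A.
have [l1_gt0 [l1mu l1nu l1L l1U]] := hl1; have [r1_gt0 _] := hr1.
have [l2_gt0 _] := hl2; have [r2_gt0 _] := hr2.
have a1_gt0 : 0 < mean A1 by have := l1_gt0 nuU; lra.
have le2 k : a2 - l2 k <= a2 + r2 k.
  by have := l2_gt0 k; have := r2_gt0 k; rewrite /l2 /r2; lra.
have le1 k : a1 - l1 k <= a1 + r1 k.
  by have := l1_gt0 k; have := r1_gt0 k; rewrite /l1 /r1; lra.
have hA : IVIFN_product A1 A2 A.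
  split=> // k.
  have E m M : `[a1 * a2 - (a1 * a2 - m), a1 * a2 + (M - a1 * a2)]%classic =
      `[m, M]%classic by rewrite subKr subrKC.
  (* Since [l1 muL <= l1 muU <= l1 nuU], [hpos] keeps the left end of [A1] nonnegative for these
     three kinds. For [nuL], [hneg] makes it negative while the right end stays positive. *)
  case: k; rewrite /left_end /right_end /A /= E;
    [rewrite mul_itv_ge0 // | rewrite mul_itv_ge0 // | rewrite mul_itv_mixed //
    | rewrite mul_itv_ge0 //]; rewrite -/l1; rewrite /a1 /l1 /r1 //.
  - by lra.
  - by lra.
  - by lra.
  - by have := r1_gt0 nuL; lra.
split; first by split=> // B hB; exact: product_unique hA hB.
have [hl hr] := product_admissible hl1 hr1 hl2 hr2 a1_gt0 hA.
exact: admissible_LR_IVIFN.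
Qed.
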